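(* In the setting of the context, let $g\in L_+(H)^E$ fulfill flow conservation at all $v\notin\{s,d\}$, have a net outflow rate $r_s\in L_+(H)\setminus\{0\}$ at $s$, and satisfy $\nabla^u_d g\le0$. Then there exist an $s$,$d$-walk $w$ and $h_w\in L_+(H)\setminus\{0\}$ such that $\ell^u_w(h_w)$ exists and $\ell^u_w(h_w)\le g$, $h_w\le r_s$, and $\nabla^u_d\ell^u_w(h_w)\ge\nabla^u_d g$.
   Context: $G=(V,E)$ finite directed graph with source $s$ and destination $d$, every node connected to $s$; $\delta^\pm(v)$ edges leaving/entering $v$. $H=[0,t_f]$ with Borel $\sigma$-algebra $\mathcal B(H)$ and Lebesgue measure $\sigma$; $L(H)$ integrable real functions up to a.e. equality, $L_+(H)$ nonnegative ones. A walk is $w=(e_1,\dots,e_k)$, $e_j=(v_j,v_{j+1})\in E$, $w[j]=e_j$, $|w|=k$. Fix $u\in L(H)^E$ with induced nonnegative absolutely continuous traversal times $D_e(u,\cdot)$ such that $T_e(u,t):=t+D_e(u,t)$ is nondecreasing; $A_{w,1}(u,\cdot)=\mathrm{id}$, $A_{w,j}(u,\cdot)=T_{w[j-1]}(u,\cdot)\circ\dots\circ T_{w[1]}(u,\cdot)$. Standing assumption: $u$ vanishes a.e. on $[t_f',t_f]$ for some $t_f'<t_f$ and all $A_{w,j}(u,\cdot)$ map $H$ into $H$. $\ell^u_{w,e}(h)$ denotes (if it exists) the function in $L(H)$ with $\int_0^t\ell^u_{w,e}(h)\,d\sigma=\sum_{j\le|w|:w[j]=e}\int_{A_{w,j}(u,\cdot)^{-1}([0,t])}h\,d\sigma$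 for all $t$; $\ell^u_w(h)=(\ell^u_{w,e}(h))_{e\in E}$. For $f\in L(H)^E$, $\nabla^u_v f$ is the signed measure $\mathfrak T\mapsto\sum_{e\in\delta^+(v)}\int_{\mathfrak T}f_e\,d\sigma-\sum_{e\in\delta^-(v)}\int_{T_e(u,\cdot)^{-1}(\mathfrak T)}f_e\,d\sigma$; inequalities between such measures hold setwise for all $\mathfrak T\in\mathcal B(H)$ ($\nabla^u_d g\le0$ means nonpositive on all Borel sets). $f$ has net outflow rate $r_v$ at $v$ if $\nabla^u_v f=r_v\cdot\sigma$; flow conservation at $v$ means $r_v=0$. *)

(* Defs.v *)
From HB Require Import structures.
From mathcomp Require Export all_boot all_order all_algebra.
From mathcomp Require Export all_classical all_reals all_analysis.

Set Implicit Arguments.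
Unset Strict Implicit.
Unset Printing Implicit Defensive.

Import Order.TTheory GRing.Theory Num.Theory.
Import numFieldNormedType.Exports.

Local Open Scope classical_set_scope.
Local Open Scope ring_scope.

Section Walks.
Context {V : finType} {E : {set V * V}}.

Definition edge (F : {set V * V}) := {e : V * V | e \in F}.

Definition src (e : edge E) : V := (val e).1.
Definition tgt (e : edge E) : V := (val e).2.

Definition is_walk (w : seq (edge E)) : bool :=
  sorted (fun e e' => tgt e == src e') w.

Definition is_walk_between (v v' : V) (w : seq (edge E)) : bool :=
  if w is e :: p then
    [&& is_walk w, src e == v & tgt (last e p) == v']
  else false.

End Walks.

Definition all_reachable (V : finType) (E : {set V * V}) (s : V) : Prop :=
  forall v : V, connect (fun x y => (x, y) \in E) s v.

(* Elements of L(H) are represented by functions R -> R, of which only the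
   values on H = [0, tf] matter, and every relation between such elements holds
   almost everywhere on H. *)
Section Horizon.
Context {R : realType}.
Variable tf : R.

Local Notation leb := (@lebesgue_measure R).

Definition horizon : set R := `[0, tf]%classic.

Definition in_L (f : R -> R) : Prop := leb.-integrable horizon (EFin \o f).

Definition le_L (f g : R -> R) : Prop :=
  {ae leb, forall t, horizon t -> f t <= g t}.

Definition eq_L (f g : R -> R) : Prop :=
  {ae leb, forall t, horizon t -> f t = g t}.

Definition in_Lplus (f : R -> R) : Prop := in_L f /\ le_L (cst 0) f.

Definition borel_in_horizon (S : set R) : Prop :=
  measurable S /\ S `<=` horizon.

Definition absolutely_continuous (f : R -> R) : Prop :=
  forall eps : R, 0 < eps -> exists2 delta : R, 0 < delta &
    forall (n : nat) (a b : 'I_n -> R),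
      (forall i, 0 <= a i /\ a i <= b i /\ b i <= tf) ->
      trivIset setT (fun i => `]a i, b i[%classic) ->
      \sum_(i < n) (b i - a i) < delta ->
      \sum_(i < n) `|f (b i) - f (a i)| < eps.

End Horizon.

Section Flows.
Context {R : realType} {V : finType} {E : {set V * V}}.
Variable tf : R.
Variable D : (edge E -> R -> R) -> edge E -> R -> R.
Variable u : edge E -> R -> R.

Local Notation leb := (@lebesgue_measure R).

Definition exit_time (e : edge E) (t : R) : R := t + D u e t.

(* Positions are counted from 0: [arrival w j] is A_{w,j+1}, the composition of
   the exit times of the first j edges of w, for 0 <= j <= |w|. *)
Definition arrival (w : seq (edge E)) (j : nat) (t : R) : R :=
  foldl (fun t e => exit_time e t) t (take j w).

Definition is_ell (w : seq (edge E)) (e : edge E) (h l : R -> R) : Prop :=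
  in_L tf l /\
  forall t, horizon tf t ->
    \int[leb]_(x in `[0, t]) l x =
    \sum_(j < size w | tnth (in_tuple w) j == e)
      \int[leb]_(x in horizon tf `&` arrival w j @^-1` `[0, t]) h x.

Definition nabla (v : V) (f : edge E -> R -> R) (S : set R) : R :=
  \sum_(e : edge E | src e == v) \int[leb]_(x in S) f e x
  - \sum_(e : edge E | tgt e == v)
      \int[leb]_(x in horizon tf `&` exit_time e @^-1` S) f e x.

Definition has_net_outflow_rate (v : V) (f : edge E -> R -> R) (r : R -> R)
    : Prop :=
  forall S, borel_in_horizon tf S -> nabla v f S = \int[leb]_(x in S) r x.

Definition flow_conservation (v : V) (f : edge E -> R -> R) : Prop :=
  has_net_outflow_rate v f (cst 0).

Definition admissible_traversal_times : Prop :=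
  forall e : edge E,
    [/\ forall t, horizon tf t -> 0 <= D u e t,
        absolutely_continuous tf (D u e) &
        forall t t', horizon tf t -> horizon tf t' -> t <= t' ->
          exit_time e t <= exit_time e t'].

Definition vanishes_before_end : Prop :=
  exists tf' : R, [/\ 0 <= tf', tf' < tf &
    forall e : edge E,
      {ae leb, forall t, `[tf', tf]%classic t -> u e t = 0}].

(* The bound j <= |w| includes A_{w,|w|+1}, the arrival at the end of w. *)
Definition arrivals_in_horizon : Prop :=
  forall w : seq (edge E), is_walk w -> forall j : nat, (j <= size w)%N ->
    forall t, horizon tf t -> horizon tf (arrival w j t).

End Flows.

(* Main.v *)
(* View each edge flow as a finite measure [m e] on times of departure, so
   that the inflow at a node [v] is a finite measure [nu v] dominating the
   sum of the [m e] over the edges [e] leaving [v], with equality except at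
   [d]. The Radon-Nikodym derivatives [p e = d(m e)/d(nu (src e))] define a
   random routing: a particle at [v] at time [x] takes the edge [e] with
   probability [p e x] and is absorbed with the leftover probability, which
   [nu v]-almost surely vanishes unless [v = d]. Releasing the mass [rs] at
   [s], the total mass routed along [e] is at most [m e], and the mass
   absorbed at [d] is at most the net inflow of [g] there. If almost nothing
   were absorbed, the particles would make [n] steps for every [n], so the
   total flow would be at least [n] times the mass of [rs]. So a positive
   mass is absorbed, and as there are countably many walks, a positive part
   of it follows a single walk [w]; its density at the start is [hw]. *)

From HB Require Import structures.
From mathcomp Require Import measurable_realfun.
From mathcomp Require Import ring lra.
Require Import Defs.
Import Order.TTheory GRing.Theory Num.Theory.
Local Open Scope classical_set_scope.
Local Open Scope ring_scope.

Set Implicit Arguments.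
Unset Strict Implicit.
Unset Printing Implicit Defensive.

(** * Densities and finite measures *)

Section Measures.
Local Open Scope ereal_scope.

(** The hypothesis [laE] makes [mu]-null sets [la]-null, so [la] has a Radon-Nikodym derivative for
    which the change of variables is known. It has the same integral as [p] over every measurable
    set, so the two agree [mu]-almost everywhere. *)
Lemma ge0_integral_density d (T : measurableType d) (R : realType)
    (la : {finite_measure set T -> \bar R})
    (mu : {sigma_finite_measure set T -> \bar R}) (p : T -> \bar R) :
  measurable_fun setT p -> (forall x, 0 <= p x) ->
  (forall A, measurable A -> la A = \int[mu]_(x in A) p x) ->
  forall (f : T -> \bar R) A, measurable A ->
    measurable_fun A f -> (forall x, 0 <= f x) ->
  \int[la]_(x in A) f x = \int[mu]_(x in A) (f x * p x).
Proof.
move=> mp p0 laE f A mA mf f0.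
have lamu : la `<< mu.
  apply/null_content_dominatesP => B mB muB0.
  by rewrite laE// null_set_integral//; apply: (measurable_funS measurableT).
rewrite -(Radon_Nikodym_SigmaFinite.change_of_variables lamu)//.
have fi := Radon_Nikodym_SigmaFinite.f_integrable lamu.
have mRN := measurable_int _ fi.
apply: ge0_ae_eq_integral => //.
- by apply: emeasurable_funM => //; exact: measurable_funTS.
- by apply: emeasurable_funM => //; exact: measurable_funTS.
- by move=> x _; rewrite mule_ge0// Radon_Nikodym_SigmaFinite.f_ge0.
- by move=> x _; rewrite mule_ge0.
- apply: ae_eqe_mul2l; apply: integral_ae_eq => //.
  + exact: (integrableS measurableT).
  + exact: measurable_funTS.
  + by move=> B _ mB; rewrite -laE// -Radon_Nikodym_SigmaFinite.f_integral.
Qed.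

(** Radon-Nikodym derivatives satisfy the bound on their sum only almost everywhere. Resetting them
    to 0 on the null set where the sum exceeds 1 makes the bound hold at every point, as routing
    probabilities require. *)
Lemma subprobability_densities d (T : measurableType d) (R : realType)
    (I : finType) (P : pred I) (m : I -> {finite_measure set T -> \bar R})
    (nu : {finite_measure set T -> \bar R}) :
  (forall A, measurable A -> \sum_(i | P i) m i A <= nu A) ->
  exists p : I -> T -> R, [/\ forall i, measurable_fun setT (p i),
    forall i x, (0 <= p i x)%R, forall x, (\sum_(i | P i) p i x <= 1)%R &
    forall i A, P i -> measurable A -> m i A = \int[nu]_(x in A) (p i x)%:E].
Proof.
move=> mnu.
have mnui i : P i -> m i `<< nu.
  move=> Pi; apply/null_content_dominatesP => A mA nuA0.
  apply/eqP; rewrite -measure_le0 -nuA0; apply: le_trans (mnu _ mA).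
  by rewrite (bigD1 i)//= leeDl// sume_ge0.
have /choice[f fP] : forall i, exists f : T -> \bar R,
    [/\ forall x, 0 <= f x, forall x, f x \is a fin_num,
    measurable_fun setT f &
    P i -> forall A, measurable A -> m i A = \int[nu]_(x in A) f x].
  move=> i; case: (boolP (P i)) => Pi; last first.
    by exists (cst 0); split => //; exact: measurable_cst.
  have [f [f0 ffin fi fE]] := radon_nikodym_sigma_finite (mnui _ Pi).
  by exists f; split => //; exact: measurable_int fi.
have f0 i x : 0 <= f i x by case: (fP i).
have ffin i x : f i x \is a fin_num by case: (fP i).
have mf i : measurable_fun setT (f i) by case: (fP i).
have fE i A : P i -> measurable A -> m i A = \int[nu]_(x in A) f i x.
  by move=> Pi; case: (fP i) => _ _ _; exact.
pose F x := \sum_(i | P i) f i x.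
have mF : measurable_fun setT F.
  by rewrite /F; under eq_fun do rewrite -big_filter; exact: emeasurable_sum.
pose B := [set x | 1 < F x].
have mB : measurable B.
  by rewrite -[B]setTI; apply: emeasurable_fun_o_infty.
have F0 x : 0 <= F x by apply: sume_ge0.
have Ffin x : F x \is a fin_num by apply/sum_fin_numP.
(* Integrating [F] over [B] gives at most [nu B], so the nonnegative function [F - 1] has integral 0
   over [B]. It is positive throughout [B], hence [B] is null. *)
have nuB : nu B = 0.
  have intF : \int[nu]_(x in B) F x <= nu B.
    rewrite /F; under eq_integral do rewrite -big_filter.
    rewrite ge0_integral_sum//; last by move=> i; exact: measurable_funTS.
    rewrite big_filter; under eq_bigr => i Pi do rewrite -fE//.
    exact: mnu.
  have mF1 : measurable_fun B (fun x => F x - 1).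
    by apply: emeasurable_funB => //; exact: measurable_funTS.
  have F10 x : B x -> 0 <= F x - 1 by move=> /ltW; rewrite sube_ge0.
  have : \int[nu]_(x in B) `|F x - 1| = 0.
    apply/eqP; rewrite eq_le integral_ge0 ?andbT//.
    under eq_integral => x /[1!inE] /F10 F10x do rewrite gee0_abs//.
    rewrite -(@leeD2rE _ (nu B)) ?fin_num_measure// add0e.
    have nuBE : nu B = \int[nu]_(x in B) 1.
      by rewrite -[LHS]mul1e -(integral_cst nu mB 1).
    rewrite {1}nuBE -ge0_integralD//.
    apply: le_trans intF; under eq_integral do rewrite subeK//.
    by [].
  move/(ae_eq_integral_abs nu mB mF1) => [N [mN N0 BN]].
  apply: subset_measure0 N0 => // x Bx; apply: BN => /(_ Bx) F1.
  by move: (Bx); rewrite /B/= -sube_gt0 F1 ltxx.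
pose p i x := if x \in B then 0%R else fine (f i x).
have mp i : measurable_fun setT (p i).
  apply: measurable_fun_ifT => //.
    by apply: (measurable_fun_bool true); rewrite setTI preimage_mem_true.
  exact: measurableT_comp.
have p0 i x : (0 <= p i x)%R by rewrite /p; case: ifP => // _; rewrite fine_ge0.
exists p; split => //.
- move=> x; rewrite /p; case: (boolP (x \in B)) => [_|].
    by rewrite big1// ler01.
  rewrite notin_setE /B/= => /negP; rewrite -leNgt => Fx.
  rewrite -lee_fin -sumEFin; apply: le_trans Fx.
  by rewrite le_eqVlt; apply/orP; left; apply/eqP/eq_bigr => i _; rewrite fineK.
- move=> i A Pi mA; rewrite fE//.
  apply: ge0_ae_eq_integral => //.
  + exact: measurable_funTS.
  + by apply/measurable_EFinP; exact: measurable_funTS.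
  + by move=> x _; rewrite lee_fin.
  + exists B; split => // x /=; apply: contra_notP => Bx _.
    by rewrite /p memNset// fineK.
Qed.

Lemma dominated_density d (T : measurableType d) (R : realType)
    (m nu : {finite_measure set T -> \bar R}) :
  (forall A, measurable A -> m A <= nu A) ->
  exists p : T -> R, [/\ measurable_fun setT p, forall x, (0 <= p x <= 1)%R &
    forall A, measurable A -> m A = \int[nu]_(x in A) (p x)%:E].
Proof.
move=> mnu; have [|p [mp p0 p1 mE]] :=
    @subprobability_densities _ T R unit predT (fun=> m) nu.
  by move=> A mA; rewrite (big_pred1 tt) ?mnu// => -[].
exists (p tt); split => // [x|A mA]; last exact: mE.
by rewrite p0/=; apply: le_trans (p1 x); rewrite (big_pred1 tt)// => -[].
Qed.

Section FiniteMeasures.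
Context d (T : measurableType d) (R : realType).

(** Packs a measure of finite total mass into the structure of finite measures; since the values
    agree, integrals carry over as well. *)
Lemma finite_measure_of (mu : {measure set T -> \bar R}) : mu setT < +oo ->
  exists nu : {finite_measure set T -> \bar R}, forall A, nu A = mu A.
Proof.
move=> muT; have fmu : fin_num_fun mu.
  move=> A mA; rewrite ge0_fin_numE//; apply: le_lt_trans muT.
  by apply: le_measure; rewrite ?inE.
have sigmafmu : sigma_finite setT mu.
  by apply: fin_num_fun_sigma_finite; rewrite ?measure0.
pose fin := isFinite.Build _ _ _ _ fmu.
pose sfin := isSFinite.Build _ _ _ _ (sfinite_measure_sigma_finite sigmafmu).
pose sigmafin := isSigmaFinite.Build _ _ _ _ sigmafmu.
by exists (HB.pack_for (FiniteMeasure.type T R) (Measure.sort mu)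
  fin sfin sigmafin).
Qed.

Lemma finite_measure_density (mu : {measure set T -> \bar R})
    (f : T -> \bar R) :
  measurable_fun setT f -> (forall x, 0 <= f x) -> \int[mu]_x f x < +oo ->
  exists nu : {finite_measure set T -> \bar R},
    forall A, nu A = \int[mu]_(x in A) f x.
Proof.
move=> mf f0 foo; pose la A := \int[mu]_(x in A) f x.
have la0 : la set0 = 0 by rewrite /la integral_set0.
have la_ge0 A : 0 <= la A by rewrite /la integral_ge0.
pose nu : {measure set T -> \bar R} := HB.pack la
  (isMeasure.Build _ _ _ la la0 la_ge0 (semi_sigma_additive_nng_induced mf f0)).
by have [nu' nu'E] := @finite_measure_of nu foo; exists nu'.
Qed.

Lemma finite_measure_sum (I : Type) (r : seq I)
    (m : I -> {finite_measure set T -> \bar R}) :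
  exists2 nu : {finite_measure set T -> \bar R},
    forall A, nu A = \sum_(i <- r) m i A &
    forall f, measurable_fun setT f -> (forall x, 0 <= f x) ->
      \int[nu]_x f x = \sum_(i <- r) \int[m i]_x f x.
Proof.
elim: r => [|i r [nu nuE nuI]].
  have [nu nuE] : exists nu : {finite_measure set T -> \bar R},
      forall A, nu A = (@mzero _ T R) A.
    by apply: (@finite_measure_of mzero); rewrite /mzero ltry.
  exists nu => [A|f mf f0]; rewrite big_nil ?nuE//.
  rewrite (eq_measure_integral mzero) => [|A _ _]; last exact: nuE.
  by rewrite integral_measure_zero.
have [la laE] : exists la : {finite_measure set T -> \bar R},
    forall A, la A = measure_add (m i) nu A.
  apply: (@finite_measure_of (measure_add (m i) nu)).
  rewrite [ltLHS]measure_addE lte_add_pinfty// -ge0_fin_numE//.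
    exact: fin_num_measure.
  exact: fin_num_measure.
exists la => [A|f mf f0]; rewrite big_cons.
  by rewrite laE measure_addE; congr (_ + _); exact: nuE.
rewrite (eq_measure_integral (measure_add (m i) nu)) => [|A _ _]; last exact: laE.
by rewrite ge0_integral_measure_add// nuI.
Qed.

End FiniteMeasures.

Lemma finite_measure_pushforward d d' (T : measurableType d)
    (U : measurableType d') (R : realType) (m : {finite_measure set T -> \bar R})
    (f : T -> U) : measurable_fun setT f ->
  exists2 nu : {finite_measure set U -> \bar R},
    forall A, nu A = m (f @^-1` A) &
    forall g, measurable_fun setT g -> (forall x, 0 <= g x) ->
      \int[nu]_x g x = \int[m]_x g (f x).
Proof.
move=> mf.
have [nu nuE] : exists nu : {finite_measure set U -> \bar R},
    forall A, nu A = pushforward m f A.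
  apply: (@finite_measure_of _ _ _ (pushforward m f)).
  have : m (f @^-1` setT) < +oo.
    by rewrite preimage_setT -ge0_fin_numE//; exact: fin_num_measure.
  by apply.
exists nu => // g mg g0.
rewrite (eq_measure_integral (pushforward m f)) => [|A _ _]; last exact: nuE.
by rewrite ge0_integral_pushforward// => y _.
Qed.

End Measures.

(** * Random routing *)

Section Routing.
Context {V : finType} {E : {set V * V}} {R : realType} {X : Type}.
Variables (T : edge E -> X -> X) (p : edge E -> X -> R).
Hypothesis p_ge0 : forall e x, 0 <= p e x.
Hypothesis p_le1 : forall v x, \sum_(e : edge E | src e == v) p e x <= 1.

(* Expected reward that a particle, at node [v] at time [x], collects at its first
   [n] nodes if it takes an edge [e] with probability [p e] and otherwise stops;
   [C] is the reward for visiting a node. *)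
Fixpoint value (C : V -> X -> R) (n : nat) (v : V) (x : X) : R :=
  if n is m.+1 then
    C v x + \sum_(e : edge E | src e == v) p e x * value C m (tgt e) (T e x)
  else 0.

Definition leftover (v : V) (x : X) : R :=
  1 - \sum_(e : edge E | src e == v) p e x.

Definition position (w : seq (edge E)) (j : nat) (x : X) : X :=
  foldl (fun x e => T e x) x (take j w).

(** Probability that a particle starting at time [x] takes the edges of [w] in turn. *)
Definition routed (w : seq (edge E)) (x : X) : R :=
  \prod_(j < size w) p (tnth (in_tuple w) j) (position w j x).

(** Unlike [is_walk_between], this admits the empty walk when [v = v'], which is the base case of
    the inductions on walks. *)
Fixpoint walk_from_to (v v' : V) (w : seq (edge E)) : bool :=
  if w is e :: w' then (src e == v) && walk_from_to (tgt e) v' w' else v == v'.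

Lemma leftover_ge0 v x : 0 <= leftover v x.
Proof. by rewrite subr_ge0. Qed.

Lemma leftover_le1 v x : leftover v x <= 1.
Proof. by rewrite gerBl sumr_ge0. Qed.

Lemma p_le1_edge e x : p e x <= 1.
Proof.
apply: le_trans (p_le1 (src e) x); rewrite (bigD1 e)//= lerDl.
exact: sumr_ge0.
Qed.

Lemma routed_nil x : routed [::] x = 1.
Proof. by rewrite /routed big_ord0. Qed.

Lemma routed_cons e w x : routed (e :: w) x = p e x * routed w (T e x).
Proof.
rewrite /routed big_ord_recl/=; congr (_ * _); apply: eq_bigr => j _.
by rewrite (tnth_nth e) [in RHS](tnth_nth e).
Qed.

Lemma routed_ge0 w x : 0 <= routed w x.
Proof. exact: prodr_ge0. Qed.

Lemma routed_le1 w x : routed w x <= 1.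
Proof. by apply: prodr_ile1 => j _; rewrite p_ge0 p_le1_edge. Qed.

Lemma value_ge0 C n v x : (forall v x, 0 <= C v x) -> 0 <= value C n v x.
Proof.
move=> C0; elim: n v x => //= n IHn v x.
by rewrite addr_ge0// sumr_ge0// => e _; rewrite mulr_ge0.
Qed.

Lemma value_nondecreasing C n v x : (forall v x, 0 <= C v x) ->
  value C n v x <= value C n.+1 v x.
Proof.
move=> C0; elim: n v x => [|n IHn] v x; first exact: value_ge0.
by rewrite /= lerD2l ler_sum// => e _; rewrite ler_wpM2l.
Qed.

Lemma value_le C (B : R) n v x : 0 <= B -> (forall v x, C v x <= B) ->
  value C n v x <= B *+ n.
Proof.
move=> B0 CB; elim: n v x => //= n IHn v x.
rewrite mulrS lerD//; apply: (@le_trans _ _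
    (\sum_(e : edge E | src e == v) p e x * (B *+ n))).
  by rewrite ler_sum// => e _; rewrite ler_wpM2l.
by rewrite -mulr_suml ler_piMl// mulrn_wge0.
Qed.

(** Splits the reward of [value_leftover_ge] into visits, absorption at the destination and
    absorption elsewhere. *)
Lemma value_linear a b C1 C2 n v x :
  value (fun v x => a * C1 v x + b * C2 v x) n v x =
  a * value C1 n v x + b * value C2 n v x.
Proof.
elim: n v x => [|n IHn] v x /=; first by rewrite !mulr0 addr0.
under eq_bigr do rewrite IHn mulrDr !(mulrCA (p _ _)).
rewrite big_split/= -!mulr_sumr; ring.
Qed.

(* Within [n] steps a particle either is left over or makes [n] steps. *)
Lemma value_leftover_ge (c : R) n v x : n%:R <= c ->
  n%:R <= value (fun v x => 1 + c * leftover v x) n v x.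
Proof.
elim: n v x => //= n IHn v x nc; set S := \sum_(e | _) _.
have {IHn} : n%:R * (1 - leftover v x) <= S.
  rewrite /leftover opprB addrC subrK mulr_sumr ler_sum// => e _.
  by rewrite mulrC ler_wpM2l// IHn// (le_trans _ nc)// ler_nat.
have : n.+1%:R * leftover v x <= c * leftover v x.
  by rewrite ler_wpM2r ?leftover_ge0.
rewrite -natr1; have := leftover_ge0 v x; lra.
Qed.

(** A positive expectation has a positive contribution: either from the current node, where the
    empty walk works, or from some edge, whose head is treated by induction. *)
Lemma value_gt0_walk C n v v' x : (forall v x, 0 <= C v x) ->
  0 < value (fun v x => if v == v' then C v x else 0) n v x ->
  exists w, walk_from_to v v' w /\
            0 < routed w x * C v' (position w (size w) x).
Proof.
move=> C0; elim: n v x => [|n IHn] v x /=; first by rewrite ltxx.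
set S := \sum_(e | _) _; move=> CS.
have [S0|S0] := ltP 0 S; last first.
  have : 0 < if v == v' then C v x else 0.
    by rewrite (lt_le_trans CS)// gerDl.
  case: eqP => [->|]; last by rewrite ltxx.
  by exists [::]; rewrite /= eqxx routed_nil mul1r.
have [e /andP[ev pe]] : exists e : edge E, (src e == v) &&
   (0 < p e x * value (fun v x => if v == v' then C v x else 0) n (tgt e) (T e x)).
  apply/existsP; apply: contraLR S0 => /existsPn Sle0.
  rewrite -leNgt /S; apply: sumr_le0 => e ev.
  by have := Sle0 e; rewrite ev/= -leNgt.
have p0 : 0 < p e x.
  by rewrite lt0r p_ge0 andbT; apply: contraTneq pe => ->; rewrite mul0r ltxx.
have [w [ww wC]] := IHn _ _ (etrans (esym (pmulr_rgt0 _ p0)) pe).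
exists (e :: w); rewrite /= ev ww; split => //.
by rewrite routed_cons -mulrA pmulr_rgt0.
Qed.

(** The right-hand side is the expected sum of [f] over all passages through [e] in the first [n]
    steps. Particles following [w] account for only some of these passages, and the probability of
    completing [w] is at most that of completing the part up to the passage. *)
Lemma routed_edge_le e (f : X -> R) n v v' w x : (forall x, 0 <= f x) ->
  walk_from_to v v' w -> (size w <= n)%N ->
  \sum_(j < size w | tnth (in_tuple w) j == e) routed w x * f (position w j x)
  <= value (fun v x => if src e == v then p e x * f x else 0) n v x.
Proof.
move=> f0; have C0 v1 x1 : 0 <= if src e == v1 then p e x1 * f x1 else 0.
  by case: ifP => // _; rewrite mulr_ge0.
elim: w n v x => [|e' w IHw] [//|n] v x /=; first by rewrite big_ord0.
  by move=> _ _; rewrite big_ord0; exact: (@value_ge0 _ n.+1).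
move=> /andP[/eqP <- ww] wn.
rewrite big_mkcond big_ord_recl/=.
under eq_bigr => j _.
  rewrite (tnth_nth e) /= -(tnth_nth e (in_tuple w)).
  rewrite routed_cons -mulrA.
  over.
rewrite -big_mkcond/= lerD//.
  rewrite (tnth_nth e)/= eq_sym routed_cons -mulrA.
  case: eqP => [->|]; last by case: ifP => // _; rewrite mulr_ge0.
  by rewrite eqxx ler_wpM2l// ler_piMl// routed_le1.
rewrite -mulr_sumr (bigD1 e')//= -[leLHS]addr0 lerD//.
  by rewrite ler_wpM2l// IHw.
by rewrite sumr_ge0// => e1 _; rewrite mulr_ge0// value_ge0.
Qed.

(** Following [w] is one of the ways of collecting the reward at [v']. The end of [w] is its node
    number [size w + 1], whence the strict bound on [size w]. *)
Lemma routed_end_le (C : V -> X -> R) n v v' w x : (forall v x, 0 <= C v x) ->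
  walk_from_to v v' w -> (size w < n)%N ->
  routed w x * C v' (position w (size w) x)
  <= value (fun v x => if v == v' then C v x else 0) n v x.
Proof.
move=> C0; have C0' v1 x1 : 0 <= if v1 == v' then C v1 x1 else 0 by case: ifP.
elim: w n v x => [|e w IHw] [//|n] v x /=.
  move=> /eqP -> _; rewrite eqxx routed_nil mul1r lerDl sumr_ge0// => e _.
  by rewrite mulr_ge0// value_ge0.
move=> /andP[/eqP <- ww] wn; rewrite routed_cons -mulrA -[leLHS]add0r lerD//.
rewrite (bigD1 e)//= -[leLHS]addr0 lerD//.
  by rewrite ler_wpM2l// IHw.
by rewrite sumr_ge0// => e1 _; rewrite mulr_ge0// value_ge0.
Qed.

End Routing.

(** * Expected rewards integrated over the released mass *)

Section RoutedMass.
Context d {X : measurableType d} {R : realType} {V : finType} {E : {set V * V}}.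
Variables (s : V) (T : edge E -> X -> X) (p : edge E -> X -> R).
Hypothesis mT : forall e, measurable_fun setT (T e).
Hypothesis mp : forall e, measurable_fun setT (p e).
Hypothesis p_ge0 : forall e x, 0 <= p e x.
Hypothesis p_le1 : forall v x, \sum_(e : edge E | src e == v) p e x <= 1.

Lemma measurable_leftover v : measurable_fun setT (leftover p v).
Proof.
apply: measurable_funB => //.
by under eq_fun do rewrite -big_filter; exact: measurable_sum.
Qed.

Lemma measurable_position w j : measurable_fun setT (position T w j).
Proof.
rewrite /position; elim: (take j w) => [|e r IH] /=; first exact: measurable_id.
exact: measurableT_comp IH (mT e).
Qed.

Lemma measurable_routed w : measurable_fun setT (routed T p w).
Proof.
apply: measurable_prod => j _; apply: measurableT_comp => //.
exact: measurable_position.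
Qed.

Lemma measurable_value C n v : (forall v, measurable_fun setT (C v)) ->
  measurable_fun setT (value T p C n v).
Proof.
move=> mC; elim: n v => [|n IHn] v /=; first exact: measurable_cst.
apply: measurable_funD => //; under eq_fun do rewrite -big_filter.
apply: measurable_sum => e; apply: measurable_funM => //.
exact: measurableT_comp.
Qed.

Variables (m : edge E -> {finite_measure set X -> \bar R})
  (nu : V -> {finite_measure set X -> \bar R})
  (rho : {finite_measure set X -> \bar R}).

Local Open Scope ereal_scope.

Hypothesis m_density : forall e (f : X -> \bar R), measurable_fun setT f ->
  (forall x, 0 <= f x) ->
  \int[m e]_x f x = \int[nu (src e)]_x (f x * (p e x)%:E).
Hypothesis nu_inflow : forall v (f : X -> \bar R), measurable_fun setT f ->
  (forall x, 0 <= f x) ->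
  \int[nu v]_x f x = \sum_(e : edge E | tgt e == v) \int[m e]_x f (T e x) +
                     if v == s then \int[rho]_x f x else 0.

(* With [I n := \sum_v \int[nu v] value C n v], the recursion of [value] and the
   balance of [nu] give
   [I n.+1 + \int[rho] value C n s = \sum_v \int[nu v] C v + I n]. *)
Lemma integral_value_le (C : V -> X -> R) (B : R) n : (forall v, measurable_fun setT (C v)) ->
  (forall v x, 0 <= C v x)%R -> (forall v x, C v x <= B)%R ->
  \int[rho]_x (value T p C n s x)%:E <= \sum_v \int[nu v]_x (C v x)%:E.
Proof.
move=> mC C0 CB.
pose I n := \sum_v \int[nu v]_x (value T p C n v x)%:E.
have mval k v : measurable_fun setT (EFin \o value T p C k v).
  by apply/measurable_EFinP; exact: measurable_value.
have mCE v : measurable_fun setT (EFin \o C v) by exact/measurable_EFinP.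
have val0 k v x : 0 <= (value T p C k v x)%:E by rewrite lee_fin value_ge0.
(* Finiteness allows [I n] to be cancelled at the end. It follows from [value_le] and the finite
   mass of each [nu v]; the maximum with 0 provides the nonnegative bound that [value_le] asks
   for. *)
have Ifin : I n \is a fin_num.
  apply/sum_fin_numP => v _ _; rewrite ge0_fin_numE ?integral_ge0//.
  have B0 : (0 <= Order.max B 0)%R by rewrite le_max lexx orbT.
  apply: (@le_lt_trans _ _ (\int[nu v]_x (Order.max B 0 *+ n)%:E)).
    apply: ge0_le_integral => //=.
    - exact: mval.
    - move=> x _; rewrite lee_fin; apply: value_le => // v1 x1.
      by rewrite le_max CB.
  rewrite integral_cst// lte_mul_pinfty// ?lee_fin ?mulrn_wge0//.
  by rewrite -ge0_fin_numE// fin_num_measure.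
have Imono : I n <= I n.+1.
  apply: lee_sum => v _; apply: ge0_le_integral => //; try exact: mval.
  by move=> x _; rewrite lee_fin value_nondecreasing.
have Irec : I n.+1 + \int[rho]_x (value T p C n s x)%:E =
    \sum_v \int[nu v]_x (C v x)%:E + I n.
  pose F e := \int[m e]_x (value T p C n (tgt e) (T e x))%:E.
  have mF e : measurable_fun setT (fun x => value T p C n (tgt e) (T e x)).
    exact: (measurableT_comp (measurable_value _ _ mC)).
  have mFE e : measurable_fun setT
      (fun x => (value T p C n (tgt e) (T e x))%:E).
    exact/measurable_EFinP.
  have IE1 : I n.+1 = \sum_v \int[nu v]_x (C v x)%:E + \sum_e F e.
    rewrite (partition_big src predT)//= -big_split/=; apply: eq_bigr => v _.
    under eq_integral do rewrite /= EFinD -sumEFin -big_filter.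
    rewrite ge0_integralD//; last 4 first.
    + by move=> x _; rewrite lee_fin.
    + exact: mCE.
    + move=> x _; apply: sume_ge0 => e _.
      by rewrite lee_fin mulr_ge0// value_ge0.
    + apply: emeasurable_sum => e; apply/measurable_EFinP.
      exact: measurable_funM.
    congr (_ + _); rewrite ge0_integral_sum//; last 2 first.
    + move=> e; apply/measurable_EFinP.
      exact: measurable_funM.
    + by move=> e x _; rewrite lee_fin mulr_ge0// value_ge0.
    rewrite big_filter; apply: eq_bigr => e /eqP <-.
    rewrite /F m_density//; apply: eq_integral => x _.
    by rewrite EFinM muleC.
  rewrite IE1 -addeA; congr (_ + _).
  (* The terms [F e] came from grouping edges by tail; [nu_inflow] produces the same terms grouped
     by head, plus the mass released at [s]. *)
  rewrite /I; under [RHS]eq_bigr => v _ do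
    rewrite (nu_inflow v (mval n v) (val0 n v)).
  rewrite [RHS]big_split/=;  congr (_ + _); last first.
    rewrite (bigD1 s)//= eqxx big1 ?adde0// => v /negbTE -> //.
  rewrite (partition_big tgt predT)//=; apply: eq_bigr => v _.
  by apply: eq_bigr => e /eqP <-.
by rewrite -(leeD2rE _ _ Ifin) -Irec addeC leeD.
Qed.
End RoutedMass.

(** * A walk carrying positive mass in a flow of measures *)

Section MeasureFlow.
Local Open Scope ereal_scope.
Context d {X : measurableType d} {R : realType} {V : finType} {E : {set V * V}}.
Variables (s t : V) (T : edge E -> X -> X).
Hypothesis mT : forall e, measurable_fun setT (T e).
Variables (m : edge E -> {finite_measure set X -> \bar R})
  (rho : {finite_measure set X -> \bar R}).

(** Counting the released mass [rho] as arriving at [s] makes the balance equation uniform over all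
    nodes other than the destination. *)
Definition inflow (v : V) (A : set X) : \bar R :=
  \sum_(e : edge E | tgt e == v) m e (T e @^-1` A) +
  if v == s then rho A else 0.

Lemma inflow_measure v : exists2 nu : {finite_measure set X -> \bar R},
  forall A, nu A = inflow v A &
  forall f : X -> \bar R, measurable_fun setT f -> (forall x, 0 <= f x) ->
    \int[nu]_x f x = \sum_(e : edge E | tgt e == v) \int[m e]_x f (T e x) +
                     if v == s then \int[rho]_x f x else 0.
Proof.
have /choice[pm pmP] : forall e, exists pm : {finite_measure set X -> \bar R},
    (forall A, pm A = m e (T e @^-1` A)) /\
    (forall f : X -> \bar R, measurable_fun setT f -> (forall x, 0 <= f x) ->
      \int[pm]_x f x = \int[m e]_x f (T e x)).
  by move=> e; have [pm] := finite_measure_pushforward (m e) (mT e); exists pm.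
have [nu nuE nuI] := finite_measure_sum
  ([seq pm e | e <- index_enum (edge E) & tgt e == v] ++
   (if v == s then [:: rho] else [::])) id.
exists nu => [A|f mf f0]; rewrite ?nuE ?nuI// big_cat big_map big_filter/=.
  rewrite /inflow; congr (_ + _).
    by apply: eq_bigr => e _; case: (pmP e).
  by case: ifP => _; rewrite ?big_seq1 ?big_nil.
congr (_ + _).
  by apply: eq_bigr => e _; case: (pmP e) => _; exact.
by case: ifP => _; rewrite ?big_seq1 ?big_nil.
Qed.

Hypothesis conserved : forall v A, v != t -> measurable A ->
  \sum_(e : edge E | src e == v) m e A = inflow v A.
Hypothesis absorbing : forall A, measurable A ->
  \sum_(e : edge E | src e == t) m e A <= inflow t A.
Hypothesis rho_gt0 : 0 < rho setT.

(** The theorem for measures on an arbitrary measurable space. The bound [h <= 1] will give that the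
    walk inflow is at most the released rate, the clause on edges that the walk flow is at most the
    given flow, and the clause on [t] the comparison of net outflows at the destination. *)
Lemma routed_mass : exists (w : seq (edge E)) (h : X -> R),
  [/\ walk_from_to s t w, measurable_fun setT h, forall x, (0 <= h x <= 1)%R,
      0 < \int[rho]_x (h x)%:E &
      (forall e A, measurable A ->
        \sum_(j < size w | tnth (in_tuple w) j == e)
          \int[rho]_(x in position T w j @^-1` A) (h x)%:E <= m e A) /\
      (forall A, measurable A ->
        \int[rho]_(x in position T w (size w) @^-1` A) (h x)%:E +
        \sum_(e : edge E | src e == t) m e A <= inflow t A)].
Proof.
have /choice[nu nuP] : forall v, exists nu : {finite_measure set X -> \bar R},
    (forall A, nu A = inflow v A) /\
    (forall f : X -> \bar R, measurable_fun setT f -> (forall x, 0 <= f x) ->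
    \int[nu]_x f x = \sum_(e : edge E | tgt e == v) \int[m e]_x f (T e x) +
                     if v == s then \int[rho]_x f x else 0).
  by move=> v; have [nu] := inflow_measure v; exists nu.
have nuE v A : nu v A = inflow v A by case: (nuP v).
have nuI v := (nuP v).2.
have out_le v A : measurable A ->
    \sum_(e : edge E | src e == v) m e A <= nu v A.
  move=> mA; rewrite nuE; have [->|vt] := eqVneq v t; first exact: absorbing.
  by rewrite conserved.
have /choice[pv pvP] v := subprobability_densities (out_le v).
(* Each node has its own family of densities; an edge uses the one of its tail. *)
pose p e := pv (src e) e.
have mp e : measurable_fun setT (p e) by case: (pvP (src e)) => + _ _ _; exact.
have p_ge0 e x : (0 <= p e x)%R by case: (pvP (src e)) => _ + _ _; exact.
have p_le1 v x : (\sum_(e : edge E | src e == v) p e x <= 1)%R.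
  case: (pvP v) => _ _ /(_ x) + _; congr (_ <= _)%R.
  by apply: eq_bigr => e /eqP <-.
have mE e A : measurable A -> m e A = \int[nu (src e)]_(x in A) (p e x)%:E.
  by move=> mA; case: (pvP (src e)) => _ _ _; exact.
have mpE e : measurable_fun setT (EFin \o p e) by exact/measurable_EFinP.
have mI e (f : X -> \bar R) : measurable_fun setT f -> (forall x, 0 <= f x) ->
    \int[m e]_x f x = \int[nu (src e)]_x (f x * (p e x)%:E).
  move=> mf f0; apply: (ge0_integral_density (mpE e)) => //.
    by move=> x; rewrite lee_fin.
  exact: mE.
have bound := integral_value_le mT mp p_ge0 p_le1 mI nuI.
pose q := leftover p.
have mq v : measurable_fun setT (q v) by exact: measurable_leftover.
have q0 v x : (0 <= q v x)%R by exact: leftover_ge0.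
have q1 v x : (q v x <= 1)%R by exact: leftover_le1.
(* The mass arriving at [v] splits into the part absorbed there and the part that leaves. *)
have qE v A : measurable A ->
    \int[nu v]_(x in A) (q v x)%:E + \sum_(e : edge E | src e == v) m e A = nu v A.
  move=> mA; pose S x := (\sum_(e : edge E | src e == v) p e x)%R.
  have mS : measurable_fun setT S.
    by rewrite /S; under eq_fun do rewrite -big_filter; exact: measurable_sum.
  have -> : \sum_(e : edge E | src e == v) m e A = \int[nu v]_(x in A) (S x)%:E.
    under [RHS]eq_integral do rewrite -sumEFin -big_filter.
    rewrite ge0_integral_sum//; last 2 first.
    - by move=> e; apply: measurable_funTS; apply/measurable_EFinP.
    - by move=> e x _; rewrite lee_fin.
    by rewrite big_filter; apply: eq_bigr => e /eqP <-; exact: mE.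
  rewrite -ge0_integralD//; last 4 first.
  - by move=> x _; rewrite lee_fin.
  - by apply/measurable_EFinP; exact: measurable_funTS.
  - by move=> x _; rewrite lee_fin sumr_ge0.
  - by apply/measurable_EFinP; exact: measurable_funTS.
  under eq_integral do rewrite -EFinD /q /leftover subrK.
  by rewrite integral_cst// mul1e.
have [w [ww hw]] : exists w, walk_from_to s t w /\
    0 < \int[rho]_x (routed T p w x * q t (position T w (size w) x))%:E.
  pose qt v x := (if v == t then q v x else 0)%R.
  pose qn v x := (if v == t then 0 else q v x)%R.
  have mqt v : measurable_fun setT (qt v).
    by rewrite /qt; case: (v == t); [exact: mq|exact: measurable_cst].
  have mqn v : measurable_fun setT (qn v).
    by rewrite /qn; case: (v == t); [exact: measurable_cst|exact: mq].
  have qt0 v x : (0 <= qt v x)%R by rewrite /qt; case: ifP.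
  have qn0 v x : (0 <= qn v x)%R by rewrite /qn; case: ifP.
  have qn1 v x : (qn v x <= 1)%R by rewrite /qn; case: ifP.
  (* By conservation, nothing is absorbed at nodes other than [t]. *)
  have int_qn n : \int[rho]_x (value T p qn n s x)%:E = 0.
    apply/eqP; rewrite eq_le integral_ge0 ?andbT//; last first.
      by move=> x _; rewrite lee_fin value_ge0.
    apply: le_trans (bound qn 1%R n mqn qn0 qn1) _.
    apply: sume_le0 => v _; rewrite /qn; have [_|vt] := eqVneq v t.
      by rewrite integral0.
    rewrite -(@leeD2rE _ (nu v setT)) ?fin_num_measure// add0e.
    by have := qE v setT measurableT; rewrite conserved// -nuE => ->.
  have mval C n : (forall v, measurable_fun setT (C v)) ->
      measurable_fun setT (fun x => (value T p C n s x)%:E).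
    by move=> mC; apply/measurable_EFinP; exact: measurable_value.
  have [n int_qt] : exists n, 0 < \int[rho]_x (value T p qt n s x)%:E.
    pose M := \sum_v nu v setT.
    have Mfin : M \is a fin_num by apply/sum_fin_numP => v _ _; rewrite fin_num_measure.
    have rhofin : rho setT \is a fin_num by rewrite fin_num_measure.
    (* Chosen so that [n] times the mass of [rho] exceeds [M]. Since [M] bounds the integrated
       number of visited nodes, not all particles can make [n] steps, and the others must be
       absorbed at [t]. *)
    pose n := (Num.bound (fine M / fine (rho setT))).
    exists n; rewrite ltNge; apply/negP => int_qt.
    pose one (v : V) (x : X) : R := 1%R.
    have mone v : measurable_fun setT (one v) by exact: measurable_cst.
    have one0 v x : (0 <= one v x)%R by [].
    have split_value x : (n%:R <= value T p one n s x +
        n%:R * (value T p qt n s x + value T p qn n s x))%R.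
      have := @value_leftover_ge _ _ _ _ T p p_ge0 p_le1 n%:R n s x (lexx _).
      rewrite (_ : (fun v x => 1 + _)%R = (fun v x => 1 * one v x +
          n%:R * (1 * qt v x + 1 * qn v x))%R); last first.
        apply/funext => v; apply/funext => y; rewrite /qt /qn /one /q.
        by case: (v == t); ring.
      by rewrite !value_linear !mul1r.
    have : (n%:R%:E * rho setT <= M)%E.
      have m1 := mval _ n mone; have m2 := mval _ n mqt; have m3 := mval _ n mqn.
      have m23 : measurable_fun setT (fun x =>
          (value T p qt n s x)%:E + (value T p qn n s x)%:E).
        exact: emeasurable_funD.
      have mono_ x : setT x -> 0 <= (value T p one n s x)%:E.
        by move=> _; rewrite lee_fin value_ge0.
      have mqt_ x : setT x -> 0 <= (value T p qt n s x)%:E.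
        by move=> _; rewrite lee_fin value_ge0.
      have mqn_ x : setT x -> 0 <= (value T p qn n s x)%:E.
        by move=> _; rewrite lee_fin value_ge0.
      rewrite -integral_cst//.
      apply: (@le_trans _ _ (\int[rho]_x ((value T p one n s x)%:E + n%:R%:E *
          ((value T p qt n s x)%:E + (value T p qn n s x)%:E)))).
        apply: ge0_le_integral => //=.
        - by apply: emeasurable_funD => //; exact: measurable_funeM.
        - by move=> x _; exact: split_value.
      rewrite ge0_integralD//; last 2 first.
      - by move=> x _; rewrite mule_ge0 ?lee_fin// addr_ge0 ?value_ge0.
      - exact: measurable_funeM.
      rewrite ge0_integralZl//; last first.
        by move=> x _; rewrite adde_ge0 ?lee_fin ?value_ge0.
      rewrite ge0_integralD//.
      rewrite int_qn adde0.
      have -> : \int[rho]_x (value T p qt n s x)%:E = 0.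
        by apply/eqP; rewrite eq_le int_qt integral_ge0.
      rewrite mule0 adde0.
      apply: le_trans (bound one 1%R n mone one0 (fun _ _ => lexx _)) _.
      by apply: lee_sum => v _; rewrite /one integral_cst// mul1e.
    rewrite -(fineK Mfin) -(fineK rhofin) -EFinM lee_fin leNgt => /negP; apply.
    rewrite -ltr_pdivrMr; last by rewrite fine_gt0// rho_gt0 -ge0_fin_numE.
    by apply: archi_boundP; rewrite divr_ge0// fine_ge0// sume_ge0.
  (* If no walk brings mass to absorption at [t], each walk fails for almost every starting time.
     Walks are countable through [pickle], so almost every starting time fails for all walks at
     once, and by [value_gt0_walk] its expected absorption at [t] is 0, against [int_qt]. *)
  apply: contrapT => now.
  have hw0 w : walk_from_to s t w -> {ae rho, forall x,
      (routed T p w x * q t (position T w (size w) x) = 0)%R}.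
    move=> ww; pose hw x := (routed T p w x * q t (position T w (size w) x))%R.
    have hw_ge0 x : 0 <= (hw x)%:E by rewrite lee_fin mulr_ge0// routed_ge0.
    have mhw : measurable_fun setT (EFin \o hw).
      apply/measurable_EFinP; apply: measurable_funM; first exact: measurable_routed.
      by apply: measurableT_comp => //; exact: measurable_position.
    have : \int[rho]_x `|(hw x)%:E| = 0.
      under eq_integral do rewrite gee0_abs//.
      apply/eqP; rewrite eq_le integral_ge0 ?andbT// leNgt; apply/negP => hwgt0.
      by apply: now; exists w.
    move/(ae_eq_integral_abs rho measurableT mhw).
    by apply: filterS => x hx0; apply: EFin_inj; exact: hx0.
  have : {ae rho, forall x, forall k w, @unpickle (seq (edge E)) k = Some w ->
      walk_from_to s t w -> (routed T p w x * q t (position T w (size w) x) = 0)%R}.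
    apply: (@ae_foralln _ _ _ rho (fun k x => forall w, _)) => k.
    case: unpickle => [w|]; last by apply: aeW.
    case: (boolP (walk_from_to s t w)) => ww; last first.
      by apply: aeW => x w' [<-]; rewrite (negbTE ww).
    by apply: filterS (hw0 _ ww) => x hx0 w' [<-].
  move=> hw0'; have : {ae rho, forall x, setT x ->
      (value T p qt n s x)%:E = cst 0 x}.
    apply: filterS hw0' => x /= hw0x _; congr EFin.
    apply/eqP; rewrite eq_le value_ge0// andbT leNgt; apply/negP.
    move=> /(value_gt0_walk p_ge0 q0)[w [ww]].
    by rewrite (hw0x _ _ (pickleK w))// ltxx.
  move/(ae_eq_integral (cst 0) _ measurableT (mval _ _ mqt) (measurable_cst _)).
  by move=> int0; move: int_qt; rewrite int0 integral0 ltxx.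
(* Probability of following [w] and then being absorbed at its end. *)
pose h x := (routed T p w x * q t (position T w (size w) x))%R.
have mh : measurable_fun setT h.
  apply: measurable_funM; first exact: measurable_routed.
  by apply: measurableT_comp => //; exact: measurable_position.
have h0 x : (0 <= h x)%R by rewrite mulr_ge0// routed_ge0.
have h_le x : (h x <= routed T p w x)%R by rewrite ler_piMr// routed_ge0.
have mhE : measurable_fun setT (EFin \o h) by exact/measurable_EFinP.
have mpre j A : measurable A -> measurable (position T w j @^-1` A).
  by move=> mA; rewrite -[X in measurable X]setTI; exact: measurable_position.
have restr j A : measurable A -> \int[rho]_(x in position T w j @^-1` A) (h x)%:E =
    \int[rho]_x (h x * \1_A (position T w j x))%:E.
  move=> mA; rewrite integral_mkcond epatch_indic.
  by apply: eq_integral => x _; rewrite EFinM.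
have mhA j A : measurable A ->
    measurable_fun setT (fun x => (h x * \1_A (position T w j x))%:E).
  move=> mA; apply/measurable_EFinP; apply: measurable_funM => //.
  apply: measurableT_comp; first exact: measurable_indic.
  exact: measurable_position.
exists w, h; split => //.
- by move=> x; rewrite h0 (le_trans (h_le x))// routed_le1.
- split => [e A mA|A mA].
  (* Reward for entering [e] at a time in [A]; its integral against the measures [nu v] is
     [m e A]. *)
  + pose C v x := (if src e == v then p e x * \1_A x else 0)%R.
    have mC v : measurable_fun setT (C v).
      rewrite /C; case: (src e == v); last exact: measurable_cst.
      by apply: measurable_funM => //; exact: measurable_indic.
    have C0 v x : (0 <= C v x)%R by rewrite /C; case: ifP => // _; rewrite mulr_ge0.
    have C1 v x : (C v x <= 1)%R.
      rewrite /C; case: ifP => // _.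
      by rewrite mulr_ile1// ?(p_le1_edge p_ge0 p_le1)// indicE lern1 leq_b1.
    under eq_bigr do rewrite restr//.
    rewrite -big_filter -ge0_integral_sum//; last 2 first.
    * by move=> j; exact: mhA.
    * by move=> j x _; rewrite lee_fin mulr_ge0.
    have -> : m e A = \sum_v \int[nu v]_x (C v x)%:E.
      rewrite (bigD1 (src e))//= big1 ?adde0 => [|v /negbTE vs]; last first.
        by rewrite /C eq_sym vs integral0.
      rewrite mE// integral_mkcond epatch_indic.
      by apply: eq_integral => x _; rewrite /C eqxx EFinM.
    apply: le_trans (bound C 1%R (size w) mC C0 C1); apply: ge0_le_integral => //.
    * by move=> x _; apply: sume_ge0 => j _; rewrite lee_fin mulr_ge0.
    * by apply: emeasurable_sum => j; exact: mhA.
    * by apply/measurable_EFinP; exact: measurable_value.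
    move=> x _; rewrite big_filter sumEFin lee_fin.
    have A0 y : (0 <= \1_A y :> R)%R by [].
    apply: le_trans (@routed_edge_le _ _ _ _ T _ p_ge0 p_le1 e _ (size w) _ _ _ x
      A0 ww (leqnn _)).
    by apply: ler_sum => j _; rewrite ler_wpM2r.
  (* Reward for absorption at a time in [A], counted at [t] only in [Ct]. By [qE] its integral is
     the excess of inflow over outflow at [t]. The walk has [size w + 1] nodes, hence the horizon
     [(size w).+1] of [value]. *)
  + pose C v x := (q v x * \1_A x)%R.
    pose Ct v x := (if v == t then C v x else 0)%R.
    have mCt v : measurable_fun setT (Ct v).
      rewrite /Ct; case: (v == t); last exact: measurable_cst.
      by apply: measurable_funM => //; exact: measurable_indic.
    have C0 v x : (0 <= C v x)%R by rewrite mulr_ge0.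
    have Ct0 v x : (0 <= Ct v x)%R by rewrite /Ct; case: ifP.
    have Ct1 v x : (Ct v x <= 1)%R.
      rewrite /Ct; case: ifP => // _.
      by rewrite mulr_ile1// indicE lern1 leq_b1.
    rewrite -nuE -qE// leeD2r// restr//.
    have -> : \int[nu t]_(x in A) (q t x)%:E = \sum_v \int[nu v]_x (Ct v x)%:E.
      rewrite (bigD1 t)//= big1 ?adde0 => [|v /negbTE vs]; last first.
        by rewrite /Ct vs integral0.
      rewrite integral_mkcond epatch_indic.
      by apply: eq_integral => x _; rewrite /Ct eqxx EFinM.
    apply: le_trans (bound Ct 1%R (size w).+1 mCt Ct0 Ct1); apply: ge0_le_integral => //.
    * by move=> x _; rewrite lee_fin mulr_ge0.
    * exact: mhA.
    * by apply/measurable_EFinP; exact: measurable_value.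
    move=> x _; rewrite lee_fin -mulrA.
    exact: (@routed_end_le _ _ _ _ T _ p_ge0 C (size w).+1 _ _ _ x C0 ww).
Qed.

End MeasureFlow.

(** * Flows over the horizon *)

Section WalkSums.
Context {V : finType} {E : {set V * V}}.

Lemma walk_from_to_is_walk_between (v v' : V) (w : seq (edge E)) :
  v != v' -> walk_from_to v v' w -> is_walk_between v v' w.
Proof.
case: w => [/negbTE /= ->//|e w _] /=; rewrite /is_walk/= => /andP[->].
elim: w e => [|e' w IHw] e /=; first by move=> ->.
by move=> /andP[/eqP <- /IHw]; rewrite eqxx.
Qed.

(** Both sides add up [a] over the positions at which the walk is at [v']: all but the first are
    heads of edges, all but the last are tails. The subtraction-free form applies to extended
    reals. *)
Lemma walk_telescope (M : nmodType) (v v' : V) (w : seq (edge E))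
    (a : nat -> M) : walk_from_to v v' w ->
  \sum_(j < size w | tgt (tnth (in_tuple w) j) == v') a j.+1 +
    (if v == v' then a 0%N else 0) =
  \sum_(j < size w | src (tnth (in_tuple w) j) == v') a j + a (size w).
Proof.
elim: w v a => [|e w IHw] v a /=.
  by move=> ->; rewrite !big_ord0.
move=> /andP[/eqP <- /(IHw _ (a \o succn))/= IH].
rewrite big_mkcond [in RHS]big_mkcond !big_ord_recl/= !(tnth_nth e)/=.
under eq_bigr do rewrite (tnth_nth e)/= -(tnth_nth e (in_tuple w)).
under [in RHS]eq_bigr do rewrite (tnth_nth e)/= -(tnth_nth e (in_tuple w)).
rewrite -!big_mkcond/= -[in RHS]addrA -IH.
by rewrite [LHS]addrC; congr (_ + _); exact: addrC.
Qed.

End WalkSums.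

(** * Measures with Lebesgue density on the horizon *)

Section LebesgueDensity.
Context {R : realType}.
Variable tf : R.
Local Notation leb := (@lebesgue_measure R).
Local Notation H := (@horizon R tf).

Lemma measurable_horizon : measurable (H : set (measurableTypeR R)).
Proof. exact: measurable_itv. Qed.

Lemma ae_lebesgueS (P Q : R -> Prop) : (forall x, P x -> Q x) ->
  {ae leb, forall x, P x} -> {ae leb, forall x, Q x}.
Proof. by move=> PQ; apply: (@filterS _ _ (ae_filter_ringOfSetsType leb)). Qed.

Lemma ae_lebesgueS2 (P Q S : R -> Prop) : (forall x, P x -> Q x -> S x) ->
  {ae leb, forall x, P x} -> {ae leb, forall x, Q x} -> {ae leb, forall x, S x}.
Proof. by move=> PQS; apply: (@filterS2 _ _ (ae_filter_ringOfSetsType leb)). Qed.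

(** A representative of an element of [L_+(H)] that is nonnegative everywhere and extended by 0, so
    that its measure lives on the whole line and ignores everything outside the horizon. *)
Record horizon_density (f : R -> R)
    (m : {finite_measure set (measurableTypeR R) -> \bar R}) : Prop := HorizonDensity {
  hd_measurable : measurable_fun [set: measurableTypeR R] f ;
  hd_ge0 : forall x, 0 <= f x ;
  hd_out : forall x, ~ H x -> f x = 0 ;
  hd_measure : forall A : set (measurableTypeR R), measurable A ->
    m A = (\int[leb]_(x in A) (f x)%:E)%E }.

Section Theory.
Variables (f : R -> R) (m : {finite_measure set (measurableTypeR R) -> \bar R}).
Hypothesis fm : horizon_density f m.

Lemma horizon_density_Rintegral (A : set (measurableTypeR R)) : measurable A ->
  (\int[leb]_(x in A) f x)%:E = m A.
Proof.
by move=> mA; rewrite /Rintegral -(hd_measure fm mA) fineK// fin_num_measure.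
Qed.

Lemma horizon_densityI (A : set (measurableTypeR R)) : measurable A -> m (A `&` H) = m A.
Proof.
move=> mA; rewrite !(hd_measure fm)//; last exact: (measurableI _ _ mA measurable_horizon).
rewrite integral_mkcondr; apply: eq_integral => x _; rewrite patchE.
by case: ifPn => // /negP xH; rewrite (hd_out fm)// => Hx; apply: xH; rewrite inE.
Qed.

Lemma horizon_density_in_Lplus : in_Lplus tf f.
Proof.
split; last by apply: aeW => x _; exact: (hd_ge0 fm).
apply: (integrableS measurableT) => //; first exact: measurable_horizon.
apply/integrableP; split; first by apply/measurable_EFinP; exact: (hd_measurable fm).
under eq_integral do rewrite /= ger0_norm ?(hd_ge0 fm)//.
by rewrite -(hd_measure fm measurableT) -ge0_fin_numE// fin_num_measure.
Qed.

End Theory.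

(** The representative is the positive part of [f] on the horizon and 0 elsewhere; on the horizon it
    differs from [f] only on a null set. *)
Lemma in_Lplus_horizon_density (f : R -> R) : in_Lplus tf f ->
  exists f' m, [/\ horizon_density f' m, eq_L tf f' f &
    forall S, borel_in_horizon tf S -> (\int[leb]_(x in S) f x)%:E = m S].
Proof.
move=> [fL f0].
pose f' x := if x \in H then Num.max (f x) 0 else 0.
have mf : measurable_fun (H : set (measurableTypeR R)) f
  by apply/measurable_EFinP; exact: measurable_int fL.
have mf' : measurable_fun [set: measurableTypeR R] f'.
  apply: measurable_fun_if => //.
    by apply: (measurable_fun_bool true); rewrite setTI preimage_mem_true;
      exact: measurable_horizon.
  rewrite setTI preimage_mem_true.
  by apply: measurable_maxr => //; exact: measurable_cst.
have f'0 x : 0 <= f' x by rewrite /f'; case: ifP => // _; rewrite le_max lexx orbT.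
have f'f : eq_L tf f' f.
  apply: ae_lebesgueS f0 => x f0 Hx; rewrite /f' mem_set//.
  by apply/max_idPl; exact: f0.
have f'out x : ~ H x -> f' x = 0.
  by move=> Hx; rewrite /f' memNset.
have f'int : (\int[leb]_x (f' x)%:E < +oo)%E.
  have fLH := (@integrable_mkcond _ (measurableTypeR R) R leb H (EFin \o f)
    measurable_horizon).1 fL.
  have /integrableP[mfH fHoo] := fLH.
  apply: le_lt_trans fHoo; apply: ge0_le_integral => //.
  - by move=> x _; rewrite lee_fin.
  - exact/measurable_EFinP.
  - exact: measurableT_comp.
  - move=> x _; rewrite /f' patchE; case: ifPn => _ /=.
      by rewrite lee_fin ge_max ler_norm normr_ge0.
    by rewrite lee_fin normr0.
have mf'E : measurable_fun [set: measurableTypeR R] (EFin \o f')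
  by exact/measurable_EFinP.
have [|m mE] := finite_measure_density mf'E _ f'int.
  by move=> x; rewrite lee_fin.
have f'm : horizon_density f' m by split => // A _; exact: mE.
exists f', m; split => // S [mS SH].
rewrite -(horizon_density_Rintegral f'm)//; congr (EFin (fine _)).
apply: ae_eq_integral => //.
- by apply/measurable_EFinP; exact: (measurable_funS measurable_horizon SH mf).
- by apply/measurable_EFinP; exact: measurable_funTS.
- by apply: ae_lebesgueS f'f => x + Sx => ->//; exact: SH.
Qed.

End LebesgueDensity.

(** * Exit times extended to the whole line *)

Section ClampedTimes.
Context {R : realType} {V : finType} {E : {set V * V}}.
Variables (tf : R) (D : (edge E -> R -> R) -> edge E -> R -> R)
  (u : edge E -> R -> R).
Hypothesis tf_ge0 : 0 <= tf.
Hypothesis Du : admissible_traversal_times tf D u.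
Hypothesis arr : arrivals_in_horizon tf D u.
Local Notation leb := (@lebesgue_measure R).
Local Notation H := (@horizon R tf).
Local Notation X := (measurableTypeR R).

(* Exit times are controlled on the horizon only; they are extended to the whole
   line by their values at the endpoints. *)
Definition clamped_exit (e : edge E) (t : X) : X :=
  exit_time D u e (Num.max 0 (Num.min t tf)).

Lemma clamped_exitE e t : H t -> clamped_exit e t = exit_time D u e t.
Proof.
rewrite /horizon/= in_itv/= => /andP[t0 ttf].
by rewrite /clamped_exit; congr exit_time; rewrite min_l// max_r.
Qed.

Lemma clamp_horizon t : H (Num.max 0 (Num.min t tf)).
Proof. by rewrite /horizon/= in_itv/= le_max lexx ge_max tf_ge0 ge_min lexx orbT. Qed.

Lemma clamped_exit_nondecreasing e : {homo (clamped_exit e : R -> R) : x y / x <= y}.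
Proof.
move=> x y xy; case: (Du e) => _ _; apply; [exact: clamp_horizon..|].
by rewrite ge_max !le_max lexx/= le_min !ge_min xy lexx !orbT.
Qed.

Lemma measurable_clamped_exit e : measurable_fun [set: X] (clamped_exit e).
Proof.
exact: (nondecreasing_measurable (measurableT : measurable [set: R])
  (@clamped_exit_nondecreasing e)).
Qed.

Lemma exit_time_horizon e t : H t -> H (exit_time D u e t).
Proof. by move=> Ht; have := arr (w := [:: e]) isT (j := 1) isT Ht. Qed.

(** Exit times map the horizon into itself, so clamping never acts along a walk that starts inside
    it. *)
Lemma position_arrival w j t : H t ->
  position clamped_exit w j t = arrival D u w j t.
Proof.
rewrite /position /arrival; elim: (take j w) t => //= e r IH t Ht.
by rewrite clamped_exitE// IH//; exact: exit_time_horizon.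
Qed.

Lemma preimage_clamped_exit e (A : set R) :
  H `&` exit_time D u e @^-1` (A `&` H) = (clamped_exit e @^-1` A) `&` H.
Proof.
apply/seteqP; split => t /=.
  by move=> [Ht [At _]]; split => //=; rewrite /preimage/= clamped_exitE.
move=> [At Ht]; split => //; split; last exact: exit_time_horizon.
by move: At; rewrite /preimage/= clamped_exitE.
Qed.

Lemma preimage_position w j (A : set R) :
  H `&` arrival D u w j @^-1` A = (position clamped_exit w j @^-1` A) `&` H.
Proof.
apply/seteqP; split => t /=.
  by move=> [Ht At]; split => //=; rewrite /preimage/= position_arrival.
by move=> [At Ht]; split => //; move: At; rewrite /preimage/= position_arrival.
Qed.

(** Translates net outflow into a balance of measures, with the arriving mass moved to the right to
    avoid subtraction. It serves both the given flow and the walk flow. *)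
Lemma nabla_measure (f : edge E -> R -> R)
    (m : edge E -> {finite_measure set X -> \bar R}) :
  (forall e S, borel_in_horizon tf S -> (\int[leb]_(x in S) f e x)%:E = m e S) ->
  (forall e (A : set X), measurable A -> m e (A `&` H) = m e A) ->
  forall v (A : set X), measurable A ->
    (\sum_(e : edge E | src e == v) m e A =
     (nabla tf D u v f (A `&` H))%:E +
     \sum_(e : edge E | tgt e == v) m e (clamped_exit e @^-1` A))%E.
Proof.
move=> fm mI v A mA.
have mAH (B : set X) : measurable B -> borel_in_horizon tf (B `&` H).
  by move=> mB; split => //; exact: (measurableI _ _ mB (measurable_horizon tf)).
have mpre e : measurable (clamped_exit e @^-1` A).
  by rewrite -[X in measurable X]setTI; exact: measurable_clamped_exit.
have outE : (\sum_(e : edge E | src e == v) m e A =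
    (\sum_(e : edge E | src e == v) \int[leb]_(x in A `&` H) f e x)%:E)%E.
  rewrite -sumEFin; apply: eq_bigr => e _.
  by rewrite (fm _ _ (mAH _ mA)) (mI _ _ mA).
have inE : (\sum_(e : edge E | tgt e == v) m e (clamped_exit e @^-1` A) =
    (\sum_(e : edge E | tgt e == v)
      \int[leb]_(x in H `&` exit_time D u e @^-1` (A `&` H)) f e x)%:E)%E.
  rewrite -sumEFin; apply: eq_bigr => e _.
  by rewrite preimage_clamped_exit (fm _ _ (mAH _ (mpre e))) (mI _ _ (mpre e)).
by rewrite outE inE /nabla -EFinD subrK.
Qed.

End ClampedTimes.

(** * Transfer from measures back to integrable functions *)

Theorem theorem3p18 (R : realType) (V : finType) (E : {set V * V}) (s d : V)
    (tf : R) (D : (edge E -> R -> R) -> edge E -> R -> R)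
    (u : edge E -> R -> R) (g : edge E -> R -> R) (rs : R -> R)
    (reach : all_reachable E s)
    (uL : forall e : edge E, in_L tf (u e))
    (Du : admissible_traversal_times tf D u)
    (u_end : vanishes_before_end tf u)
    (arr : arrivals_in_horizon tf D u)
    (gL : forall e : edge E, in_Lplus tf (g e))
    (g_cons : forall v : V, v != s -> v != d -> flow_conservation tf D u v g)
    (rsL : in_Lplus tf rs)
    (rs_neq0 : ~ eq_L tf rs (cst 0))
    (g_s : has_net_outflow_rate tf D u s g rs)
    (g_d : forall S : set R, borel_in_horizon tf S -> nabla tf D u d g S <= 0) :
  exists (w : seq (edge E)) (hw : R -> R),
    [/\ is_walk_between s d w,
        in_Lplus tf hw,
        ~ eq_L tf hw (cst 0),
        le_L tf hw rs &
        exists l : edge E -> R -> R,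
          [/\ forall e : edge E, is_ell tf D u w e hw (l e),
              forall e : edge E, le_L tf (l e) (g e) &
              forall S : set R, borel_in_horizon tf S ->
                nabla tf D u d g S <= nabla tf D u d l S]].
Proof.
have tf_ge0 : 0 <= tf by case: u_end => t [t0 ttf _]; exact/ltW/(le_lt_trans t0).
pose X := measurableTypeR R.
pose T := clamped_exit tf D u.
have mT e : measurable_fun [set: X] (T e) := measurable_clamped_exit tf_ge0 Du e.
have mH := measurable_horizon tf.
have [r [rho [rrho r_rs rhoE]]] := in_Lplus_horizon_density rsL.
have /choice[g' g'P] : forall e, exists g' : R -> R,
    exists m, [/\ horizon_density tf g' m, eq_L tf g' (g e) &
    forall S, borel_in_horizon tf S ->
      (\int[@lebesgue_measure R]_(x in S) g e x)%:E = m S].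
  by move=> e; exact: in_Lplus_horizon_density.
have [m mP] := choice g'P.
have gm e : horizon_density tf (g' e) (m e) by case: (mP e).
have g'g e : eq_L tf (g' e) (g e) by case: (mP e).
have mE e S : borel_in_horizon tf S ->
    (\int[@lebesgue_measure R]_(x in S) g e x)%:E = m e S.
  by case: (mP e) => _ _; exact.
have mAH (A : set X) : measurable A -> borel_in_horizon tf (A `&` horizon tf).
  by move=> mA; split => //; exact: (measurableI _ _ mA mH).
have nablaE := nabla_measure tf_ge0 Du arr.
have nabla_g := nablaE g m mE (fun e => horizon_densityI (gm e)).
have mHT : borel_in_horizon tf (horizon tf) by split.
have rho_gt0 : (0 < rho setT)%E.
  rewrite lt0e measure_ge0 andbT; apply/eqP => rho0; apply: rs_neq0.
  have mr : measurable_fun [set: X] (EFin \o r).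
    by apply/measurable_EFinP; exact: (hd_measurable rrho).
  have : (\int[@lebesgue_measure R]_x `|(EFin \o r) x| = 0)%E.
    rewrite -rho0 (hd_measure rrho measurableT); apply: eq_integral => x _.
    by rewrite /= ger0_norm// (hd_ge0 rrho).
  move/(ae_eq_integral_abs _ measurableT mr); apply: ae_lebesgueS2 r_rs => x.
  by move=> rsx r0 Hx; rewrite -rsx//; apply: EFin_inj; exact: r0.
(* Otherwise the total net outflow at [s] would be both positive and, by [g_d], nonpositive. *)
have sd : s != d.
  apply/eqP => sd; move: rho_gt0; apply/negP; rewrite -leNgt.
  rewrite -(horizon_densityI rrho measurableT) setTI -(rhoE _ mHT) -(g_s _ mHT).
  by rewrite lee_fin sd g_d.
have conserved v (A : set X) : v != d -> measurable A ->
    (\sum_(e : edge E | src e == v) m e A = inflow s T m rho v A)%E.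
  move=> vd mA; rewrite nabla_g// /inflow [LHS]addeC; congr (_ + _)%E.
  have [->|vs] := eqVneq v s.
    rewrite g_s; last exact: mAH.
    by rewrite (rhoE _ (mAH _ mA)) (horizon_densityI rrho).
  rewrite g_cons//; last exact: mAH.
  by rewrite /Rintegral (eq_integral (cst 0%E))// integral0.
have absorbing (A : set X) : measurable A ->
    (\sum_(e : edge E | src e == d) m e A <= inflow s T m rho d A)%E.
  move=> mA; rewrite nabla_g// /inflow eq_sym (negbTE sd) adde0.
  by rewrite geeDr// lee_fin; apply: g_d; exact: mAH.
have [w [h [ww mh h01 h_gt0 [edge_le end_le]]]] :=
  routed_mass mT conserved absorbing rho_gt0.
have h0 x : 0 <= h x by case/andP: (h01 x).
have mhE : measurable_fun [set: X] (EFin \o h) by exact/measurable_EFinP.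
have hE0 x : (0 <= (EFin \o h) x)%E by rewrite lee_fin.
have h_fin : (\int[rho]_x (EFin \o h) x < +oo)%E.
  apply: (@le_lt_trans _ _ (\int[rho]_x 1)%E).
    by apply: ge0_le_integral => // x _; rewrite lee_fin; case/andP: (h01 x).
  rewrite integral_cst// mul1e -ge0_fin_numE//; exact: fin_num_measure.
(* [kappa] measures, by starting time, the mass sent along [w]; its Lebesgue density is [hw]. *)
have [kappa kappaE] := finite_measure_density mhE hE0 h_fin.
pose hw x := h x * r x.
have hwk : horizon_density tf hw kappa.
  split.
  - apply: measurable_funM => //; exact: (hd_measurable rrho).
  - by move=> x; rewrite mulr_ge0// (hd_ge0 rrho).
  - by move=> x Hx; rewrite /hw (hd_out rrho)// mulr0.
  - move=> A mA; rewrite kappaE.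
    rewrite (@ge0_integral_density _ X R rho (@lebesgue_measure R) (EFin \o r))//.
    + by apply/measurable_EFinP; exact: (hd_measurable rrho).
    + by move=> x; rewrite lee_fin (hd_ge0 rrho).
    + exact: (hd_measure rrho).
    + exact: measurable_funTS.
have mpos j : measurable_fun [set: X] (position T w j) := measurable_position mT w j.
have mpre j (A : set X) : measurable A -> measurable (position T w j @^-1` A).
  by move=> mA; rewrite -[X in measurable X]setTI; exact: mpos.
have /choice[k kE] : forall j : 'I_(size w),
    exists k : {finite_measure set X -> \bar R},
    forall A, k A = kappa (position T w j @^-1` A).
  move=> j; have [k kE _] := finite_measure_pushforward kappa (mpos j).
  by exists k.
(* [L e] adds up the mass entering [e] over all occurrences of [e] in [w]. *)
have /choice[L LE] : forall e, exists L : {finite_measure set X -> \bar R},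
    forall A, L A = (\sum_(j < size w | tnth (in_tuple w) j == e)
      kappa (position T w j @^-1` A))%E.
  move=> e; have [L LE _] := finite_measure_sum
    [seq j <- index_enum 'I_(size w) | tnth (in_tuple w) j == e] k.
  by exists L => A; rewrite LE big_filter; apply: eq_bigr => j _; exact: kE.
have Lm e (A : set X) : measurable A -> (L e A <= m e A)%E.
  move=> mA; rewrite LE; apply: le_trans (edge_le e A mA).
  by under eq_bigr do rewrite kappaE.
(* Since [L e] is dominated by [m e], it has a density with values in [[0, 1]] with respect to it.
   Multiplying by [g' e] gives a Lebesgue density of [L e], so the walk flow exists and is at most
   [g e]. *)
have /choice[p pP] e := dominated_density (Lm e).
pose l e x := p e x * g' e x.
have lL e : horizon_density tf (l e) (L e).
  have [mp p01 pE] := pP e.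
  have p0 x : 0 <= p e x by case/andP: (p01 x).
  split.
  - by apply: measurable_funM => //; exact: (hd_measurable (gm e)).
  - by move=> x; rewrite mulr_ge0// (hd_ge0 (gm e)).
  - by move=> x Hx; rewrite /l (hd_out (gm e))// mulr0.
  - move=> A mA; rewrite pE//.
    rewrite (@ge0_integral_density _ X R (m e) (@lebesgue_measure R) (EFin \o g' e))//.
    + by apply/measurable_EFinP; exact: (hd_measurable (gm e)).
    + by move=> x; rewrite lee_fin (hd_ge0 (gm e)).
    + exact: (hd_measure (gm e)).
    + by apply/measurable_EFinP; exact: measurable_funTS.
exists w, hw; split.
- exact: walk_from_to_is_walk_between.
- exact: horizon_density_in_Lplus hwk.
- move=> hw_eq0; move: h_gt0; rewrite -(kappaE setT).
  rewrite -(horizon_densityI hwk measurableT) setTI (hd_measure hwk mH).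
  rewrite (ae_eq_integral (cst 0%E))//; first by rewrite integral0 ltxx.
  + by apply/measurable_EFinP/measurable_funTS; exact: (hd_measurable hwk).
  + by apply: ae_lebesgueS hw_eq0 => x hx Hx; rewrite hx.
- apply: ae_lebesgueS r_rs => x + Hx => <-//.
  by rewrite /hw ler_piMl ?(hd_ge0 rrho)//; case/andP: (h01 x).
exists l; split => [e|e|S [mS SH]].
- split; first by have [] := horizon_density_in_Lplus (lL e).
  move=> t Ht; apply: EFin_inj; have m0t : measurable (`[0, t]%classic : set X).
    exact: measurable_itv.
  rewrite (horizon_density_Rintegral (lL e) m0t) LE -sumEFin.
  apply: eq_bigr => j _; rewrite (preimage_position arr).
  rewrite (horizon_density_Rintegral hwk); last exact: (measurableI _ _ (mpre _ _ m0t) mH).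
  by rewrite (horizon_densityI hwk)//; exact: mpre.
- apply: ae_lebesgueS (g'g e) => x + Hx => <-//; have [_ p01 _] := pP e.
  by rewrite /l ler_piMl ?(hd_ge0 (gm e))//; case/andP: (p01 x).
- have mSX : measurable (S : set X) by [].
  have SE : S `&` horizon tf = S by exact/setIidl.
  have lE e B : borel_in_horizon tf B ->
      (\int[@lebesgue_measure R]_(x in B) l e x)%:E = L e B.
    by move=> [mB _]; exact: (horizon_density_Rintegral (lL e)).
  have nabla_l := nablaE l L lE (fun e => horizon_densityI (lL e)) d S mSX.
  have := nabla_g d S mSX; have := end_le S mSX; rewrite SE in nabla_l *.
  rewrite /inflow eq_sym (negbTE sd) adde0.
  (* [a j] is the mass that is at position [j] of [w] at a time in [S]. By [walk_telescope] the walk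
     flow has net outflow [- a (size w)] at [d], and [end_le] bounds [a (size w)] by the negated net
     outflow of [g]. *)
  pose a j := kappa (position T w j @^-1` S).
  have srcL : (\sum_(e : edge E | src e == d) L e S =
      \sum_(j < size w | src (tnth (in_tuple w) j) == d) a j)%E.
    rewrite [RHS](partition_big (tnth (in_tuple w)) (fun e => src e == d))//=.
    apply: eq_bigr => e ed; rewrite LE; apply: eq_bigl => j.
    by case: (tnth (in_tuple w) j =P e) => [->|]; rewrite ?ed ?andbF.
  have tgtL : (\sum_(e : edge E | tgt e == d) L e (T e @^-1` S) =
      \sum_(j < size w | tgt (tnth (in_tuple w) j) == d) a j.+1)%E.
    rewrite [RHS](partition_big (tnth (in_tuple w)) (fun e => tgt e == d))//=.
    apply: eq_bigr => e ed; rewrite LE; apply: eq_big => [j|j /eqP <-].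
      by case: (tnth (in_tuple w) j =P e) => [->|]; rewrite ?ed ?andbF.
    congr (kappa _).
    apply/seteqP; split => x; rewrite /preimage/= /position;
      by rewrite (take_nth (tnth (in_tuple w) j))// foldl_rcons -(tnth_nth _ (in_tuple w)).
  have := walk_telescope a ww; rewrite (negbTE sd) addr0 -srcL -tgtL nabla_l.
  rewrite -/T -kappaE -/(a (size w)).
  (* All masses are finite, so the three balances become linear relations between reals. *)
  have fin_sum (P : pred (edge E)) (mu : edge E -> {finite_measure set X -> \bar R})
      (B : edge E -> set X) : (forall e, measurable (B e)) ->
      exists x, (\sum_(e : edge E | P e) mu e (B e) = x%:E)%E.
    move=> mB; exists (fine (\sum_(e : edge E | P e) mu e (B e))%E).
    by rewrite fineK//; apply/sum_fin_numP => e _ _; exact: fin_num_measure.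
  have mTS e : measurable (T e @^-1` S).
    by rewrite -[X in measurable X]setTI; exact: mT.
  have [x1 ->] := fin_sum (fun e => tgt e == d) L _ mTS.
  have [x2 ->] := fin_sum (fun e => src e == d) m (fun=> S) (fun=> mSX).
  have [x3 ->] := fin_sum (fun e => tgt e == d) m _ mTS.
  have -> : a (size w) = (fine (a (size w)))%:E.
    by rewrite fineK// fin_num_measure//; exact: mpre.
  rewrite -!EFinD !lee_fin => tele endS gS.
  move: (EFin_inj tele) (EFin_inj gS) endS; lra.
Qed.
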